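(* Let $G\in\mathcal{F}_2$ and let $(G,w)$ be a $4$-unbalanced pair. Assume $G$ does not admit a star cutset. Let $F=a\text{-}v_1\text{-}u_1$ be a heavy seagull in $G$. Then there are two cliques $K_1,K_2$ of $G$ such that $S(K_1,K_2)$ is active and $A(K_1,K_2)\cap\{a,u_1\}\ne\emptyset$.
   Context: A seagull is an induced three-vertex path; $a\text{-}v\text{-}u$ is heavy if $\deg_G(a)>2$ and $\deg_G(u)>2$. A hole is an induced cycle of length at least four; $G$ is sparse if for every hole $H$ and vertex $z\notin V(H)$ there is an edge $pq$ of $H$ with $N(z)\cap V(H)\subseteq\{p,q\}$. $\mathcal{F}_2$ is the class of triangle-free sparse graphs with no induced pyramid or prism (pyramid: vertex $a$, triangle $\{b_1,b_2,b_3\}$, paths $P_i$ from $a$ to $b_i$ of length $\ge1$, $P_i\setminus\{a\}$ pairwise disjoint with only edge between $P_i\setminus\{a\},P_j\setminus\{a\}$ being $b_ib_j$, at most one of length one; prism: disjoint triangles $\{a_1,a_2,a_3\},\{b_1,b_2,b_3\}$ joined by pairwise disjoint paths $P_i$ from $a_i$ to $b_i$ of length $\ge1$ with only edges between $P_i,P_j$ being $a_ia_j,b_ib_j$). So every clique of $G$ has size at most $2$. A separation is a partition $(A,C,B)$ of $V(G)$ with no edges between $A$ and $B$; star separation if some $v\in C$ has $C\subseteq N[v]$; $G$ admits a star cutset if it has a star separation with $A,B\neq\emptyset$. A weight function is $w:V(G)\to[0,1]$ summing to $1$; $(G,w)$ is $d$-unbalanced if no set $X$ with $|X|\le d$ has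 every component $D$ of $G\setminus X$ of weight $\le\frac12$. For cliques $K_1,K_2$: $B(K_1,K_2)$ is the unique maximum-weight component of $G\setminus(K_1\cup K_2)$, $A(K_1,K_2)=V(G)\setminus(B(K_1,K_2)\cup K_1\cup K_2)$, $S(K_1,K_2)=(A(K_1,K_2),K_1\cup K_2,B(K_1,K_2))$. $S(K_1,K_2)$ is proper if some component $D$ of $G[A(K_1,K_2)]$ has $K_1\cup K_2\subseteq N(D)$, and, if $|K_1|=|K_2|=1$, $G[A(K_1,K_2)\cup K_1\cup K_2]$ is not a path between the vertices of $K_1$ and $K_2$. It is active if it is proper and for all cliques $K_1',K_2'$ with $S(K_1',K_2')$ proper and $K_1'\cup K_2'\ne K_1\cup K_2$: $B(K_1',K_2')\cup K_1'\cup K_2'$ is not a proper subset of $B(K_1,K_2)\cup K_1\cup K_2$, and if these sets are equal then $B(K_1',K_2')\subseteq B(K_1,K_2)$. *)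

(* Defs.v *)
From HB Require Import structures.
From mathcomp Require Import all_boot all_order all_algebra.
Set Implicit Arguments.
Unset Strict Implicit.
Unset Printing Implicit Defensive.
Import Order.TTheory GRing.Theory Num.Theory.
Local Open Scope ring_scope.

(* A finite simple graph is a symmetric irreflexive relation e on a finType. *)
Definition simple_graph (T : finType) (e : rel T) : Prop :=
  symmetric e /\ irreflexive e.

Definition nbh (T : finType) (e : rel T) (v : T) : {set T} := [set x | e v x].

Definition deg (T : finType) (e : rel T) (v : T) : nat := #|nbh e v|.

Definition nbhs (T : finType) (e : rel T) (D : {set T}) : {set T} :=
  [set x in ~: D | [exists y in D, e x y]].

Definition clique (T : finType) (e : rel T) (K : {set T}) : Prop :=
  {in K &, forall x y, x != y -> e x y}.

Definition induced_rel (T : finType) (e : rel T) (S : {set T}) : rel T :=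
  [rel x y | [&& x \in S, y \in S & e x y]].

(* Vertex sets of the connected components of G[S]. *)
Definition components (T : finType) (e : rel T) (S : {set T}) : {set {set T}} :=
  equivalence_partition (connect (induced_rel e S)) S.

(* p lists the vertices of an induced path in order; its length (number of
   edges) is (size p).-1. *)
Definition induced_path (T : finType) (e : rel T) (p : seq T) : Prop :=
  [/\ p <> [::], uniq p &
      {in p &, forall x y,
         e x y = (index y p == (index x p).+1) || (index x p == (index y p).+1)}].

(* The subgraph G[S] is a path with ends x and y. *)
Definition is_path_between (T : finType) (e : rel T) (S : {set T}) (x y : T) :
    Prop :=
  exists p : seq T,
    [/\ induced_path e (x :: p), last x p = y & [set z in x :: p] = S].

Definition seagull (T : finType) (e : rel T) (a v u : T) : Prop :=
  induced_path e [:: a; v; u].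

Definition heavy_seagull (T : finType) (e : rel T) (a v u : T) : Prop :=
  [/\ seagull e a v u, (2 < deg e a)%N & (2 < deg e u)%N].

(* c lists the vertices of the induced cycle in cyclic order. *)
Definition hole (T : finType) (e : rel T) (c : seq T) : Prop :=
  [/\ uniq c, (3 < size c)%N &
      {in c &, forall x y, e x y = (next c x == y) || (next c y == x)}].

Definition sparse (T : finType) (e : rel T) : Prop :=
  forall (c : seq T) (z : T), hole e c -> z \notin c ->
  exists p q : T, [/\ p \in c, q \in c, e p q &
    nbh e z :&: [set x in c] \subset [set p; q]].

Definition triangle_free (T : finType) (e : rel T) : Prop :=
  ~ exists x y z : T, [/\ e x y, e y z & e x z].

(* Here P_i is a :: Q i, so Q i lists P_i \ {a} and size (Q i) is the length
   of P_i. *)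
Definition has_pyramid (T : finType) (e : rel T) : Prop :=
  exists (a : T) (b : 'I_3 -> T) (Q : 'I_3 -> seq T),
    [/\ (forall i j, i != j -> e (b i) (b j)),
        (forall i, [/\ induced_path e (a :: Q i), last a (Q i) = b i &
                       (1 <= size (Q i))%N]),
        (forall i j, i != j -> [disjoint Q i & Q j]),
        (forall i j x y, i != j -> x \in Q i -> y \in Q j ->
           e x y = (x == b i) && (y == b j)) &
        (forall i j, size (Q i) = 1%N -> size (Q j) = 1%N -> i = j)].

(* Here P_i is a i :: Q i. *)
Definition has_prism (T : finType) (e : rel T) : Prop :=
  exists (a b : 'I_3 -> T) (Q : 'I_3 -> seq T),
    [/\ (forall i j, i != j -> e (a i) (a j) /\ e (b i) (b j)),
        (forall i j, a i != b j),
        (forall i, [/\ induced_path e (a i :: Q i), last (a i) (Q i) = b i &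
                       (1 <= size (Q i))%N]),
        (forall i j, i != j -> [disjoint a i :: Q i & a j :: Q j]) &
        (forall i j x y, i != j -> x \in a i :: Q i -> y \in a j :: Q j ->
           e x y = (x == a i) && (y == a j) || (x == b i) && (y == b j))].

Definition class_F2 (T : finType) (e : rel T) : Prop :=
  [/\ triangle_free e, sparse e, ~ has_pyramid e & ~ has_prism e].

(* The parts of a separation may be empty. *)
Definition separation (T : finType) (e : rel T) (A C B : {set T}) : Prop :=
  [/\ A :|: C :|: B = [set: T],
      [/\ [disjoint A & C], [disjoint A & B] & [disjoint C & B]] &
      (forall x y, x \in A -> y \in B -> ~~ e x y)].

Definition star_separation (T : finType) (e : rel T) (A C B : {set T}) : Prop :=
  separation e A C B /\ exists2 v, v \in C & C \subset v |: nbh e v.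

Definition admits_star_cutset (T : finType) (e : rel T) : Prop :=
  exists A C B : {set T}, [/\ star_separation e A C B, A != set0 & B != set0].

Definition weight_function (R : realFieldType) (T : finType) (w : T -> R) :
    Prop :=
  (forall x, 0 <= w x <= 1) /\ \sum_x w x = 1.

Definition weight (R : realFieldType) (T : finType) (w : T -> R) (S : {set T}) :
    R :=
  \sum_(x in S) w x.

Definition unbalanced (R : realFieldType) (T : finType) (e : rel T) (w : T -> R)
    (d : nat) : Prop :=
  ~ exists X : {set T}, (#|X| <= d)%N /\
      forall D, D \in components e (~: X) -> weight w D <= 1 / 2.

(* The unique component of maximum weight of G \ (K1 :|: K2).  The default
   value set0 is never reached if (G, w) is 4-unbalanced and #|K1 :|: K2| <= 4,
   since some component then has weight > 1/2. *)
Definition Bset (R : realFieldType) (T : finType) (e : rel T) (w : T -> R)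
    (K1 K2 : {set T}) : {set T} :=
  odflt set0
    [pick D in components e (~: (K1 :|: K2)) |
       [forall (D' | D' \in components e (~: (K1 :|: K2)) :\ D),
          weight w D' < weight w D]].

Definition Aset (R : realFieldType) (T : finType) (e : rel T) (w : T -> R)
    (K1 K2 : {set T}) : {set T} :=
  ~: (Bset e w K1 K2 :|: K1 :|: K2).

(* Properness and activity of S(K1, K2) = (Aset K1 K2, K1 :|: K2, Bset K1 K2)
   are predicates of the pair (K1, K2). *)
Definition proper_sep (R : realFieldType) (T : finType) (e : rel T) (w : T -> R)
    (K1 K2 : {set T}) : Prop :=
  (exists2 D, D \in components e (Aset e w K1 K2) & K1 :|: K2 \subset nbhs e D)
  /\
  (forall x y, K1 = [set x] -> K2 = [set y] ->
     ~ is_path_between e (Aset e w K1 K2 :|: K1 :|: K2) x y).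

Definition active_sep (R : realFieldType) (T : finType) (e : rel T) (w : T -> R)
    (K1 K2 : {set T}) : Prop :=
  proper_sep e w K1 K2 /\
  forall K1' K2' : {set T}, clique e K1' -> clique e K2' ->
    proper_sep e w K1' K2' -> K1' :|: K2' <> K1 :|: K2 ->
    ~~ (Bset e w K1' K2' :|: K1' :|: K2' \proper Bset e w K1 K2 :|: K1 :|: K2)
    /\
    (Bset e w K1' K2' :|: K1' :|: K2' = Bset e w K1 K2 :|: K1 :|: K2 ->
     Bset e w K1' K2' \subset Bset e w K1 K2).

(* Main.v *)
Require Import Defs.
From HB Require Import structures.
From mathcomp Require Import all_boot all_order all_algebra.
From mathcomp Require Import zify lra.
From Stdlib Require Import Classical.

Set Implicit Arguments.
Unset Strict Implicit.
Unset Printing Implicit Defensive.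

(* In a triangle-free sparse graph no vertex has two neighbours on a hole that
   avoids it.  The key point is that two nonadjacent vertices a, u of such a
   graph either lie on a common hole or are separated by a clique avoiding both.
   To see this, pass to an inclusion-minimal induced subgraph in which no clique
   separates a from u; it has no clique cutset, hence the nonneighbours of every
   vertex c induce a connected graph, and this allows one to push a hole through
   a and c to a hole through a and u whenever u is a neighbour of c.
   For a seagull a-v-u this is applied to G - v, where a hole through a and u is
   impossible because v has two neighbours on it.  So {v} and some clique K
   separate a from u, and one of a, u is outside the big component B.  Shrinking
   the two cliques to the neighbourhood of the component of that vertex gives a
   proper separation, and minimizing the complement of its A-side an active
   one. *)

(** [P] is an arbitrary proposition, so minimal objects are obtained classically here. This serves
    for shortest walks, smallest inseparable sets and best separations alike. *)
Lemma exists_minimizer (A : Type) (f : A -> nat) (P : A -> Prop) :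
  (exists x, P x) -> exists x, P x /\ forall y, P y -> f x <= f y.
Proof.
case=> x0; have [n] := ubnP (f x0); elim: n x0 => // n IHn x0 fx0 Px0.
case: (classic (exists2 y, P y & f y < f x0)) => [[y Py fy]|no_smaller].
  by apply: IHn Py; apply: leq_trans fy _.
exists x0; split=> // y Py; rewrite leqNgt; apply/negP => fy.
by apply: no_smaller; exists y.
Qed.

(** * Connected sets and chordless paths *)

Section Graph.

Variables (T : finType) (e : rel T).

Definition anticomplete (A B : {set T}) : Prop :=
  {in A & B, forall x y, ~~ e x y}.

Definition touches (x : T) (W : {set T}) : Prop := exists2 y, y \in W & e x y.

Definition connected (W : {set T}) : Prop :=
  {in W &, forall x y, connect (induced_rel e W) x y}.

Definition component (W : {set T}) (x : T) : {set T} :=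
  [set y in W | connect (induced_rel e W) x y].

(* A path satisfies this iff it is induced. *)
Definition chordless (s : seq T) : Prop :=
  forall s1 x s2, s = s1 ++ x :: s2 ->
  forall y z, y \in s1 -> z \in s2 -> ~~ e y z.

Hypotheses (e_sym : symmetric e) (e_irr : irreflexive e).

Lemma anticompleteC A B : anticomplete A B -> anticomplete B A.
Proof. by move=> AB x y xB yA; rewrite e_sym AB. Qed.

Lemma touchesS x (W W' : {set T}) : W \subset W' -> touches x W -> touches x W'.
Proof. by move/subsetP=> sW [y yW exy]; exists y => //; apply: sW. Qed.

Lemma induced_relE (W : {set T}) x y :
  induced_rel e W x y = [&& x \in W, y \in W & e x y].
Proof. by []. Qed.

Lemma induced_connect_sym W x y :
  connect (induced_rel e W) x y = connect (induced_rel e W) y x.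
Proof.
by apply: sym_connect_sym => {}x {}y; rewrite !induced_relE (e_sym x) andbCA.
Qed.

Lemma induced_connectS (W W' : {set T}) x y : W \subset W' ->
  connect (induced_rel e W) x y -> connect (induced_rel e W') x y.
Proof.
move/subsetP=> sW; apply: connect_sub => u v /= /and3P[uW vW euv].
by apply: connect1; rewrite induced_relE !sW.
Qed.

Lemma connected1 x : connected [set x].
Proof. by move=> y z /set1P-> /set1P->. Qed.

Lemma connectedU (W1 W2 : {set T}) x y : connected W1 -> connected W2 ->
  x \in W1 -> y \in W2 -> e x y -> connected (W1 :|: W2).
Proof.
move=> c1 c2 xW yW exy.
have from_x z : z \in W1 :|: W2 -> connect (induced_rel e (W1 :|: W2)) x z.
  case/setUP=> zW; first exact: induced_connectS (subsetUl _ _) (c1 _ _ xW zW).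
  apply: connect_trans (induced_connectS (subsetUr _ _) (c2 _ _ yW zW)).
  by apply: connect1; rewrite induced_relE !inE xW yW orbT.
move=> u v /from_x xu /from_x xv.
by apply: connect_trans xv; rewrite induced_connect_sym.
Qed.

Lemma connectedUI (W1 W2 : {set T}) x : connected W1 -> connected W2 ->
  x \in W1 -> x \in W2 -> connected (W1 :|: W2).
Proof.
move=> c1 c2 x1 x2.
have from_x z : z \in W1 :|: W2 -> connect (induced_rel e (W1 :|: W2)) x z.
  case/setUP=> zW; first exact: induced_connectS (subsetUl _ _) (c1 _ _ x1 zW).
  exact: induced_connectS (subsetUr _ _) (c2 _ _ x2 zW).
move=> u v /from_x xu /from_x xv.
by apply: connect_trans xv; rewrite induced_connect_sym.
Qed.

Lemma connectedU1 x W : connected W -> touches x W -> connected (x |: W).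
Proof.
move=> cW [y yW exy].
by apply: (@connectedU _ _ x y) => //; [apply: connected1|rewrite set11].
Qed.

Lemma connected_path x p : path e x p -> connected [set z in x :: p].
Proof.
elim: p x => [|y p IHp] x /=.
  have -> : [set z in [:: x]] = [set x] by apply/setP=> z; rewrite !inE.
  by move=> _; apply: connected1.
case/andP=> exy /IHp cp.
have -> : [set z in [:: x, y & p]] = x |: [set z in y :: p].
  by apply/setP=> z; rewrite !inE.
by apply: connectedU1 => //; exists y; rewrite // !inE eqxx.
Qed.

Lemma connected_behead_path x h p :
  path e x (h :: p) -> connected [set z in h :: p].
Proof. by move=> /= /andP[_]; apply: connected_path. Qed.

Lemma connected_ind (W : {set T}) (P : T -> Prop) x y :
  connected W -> x \in W -> y \in W -> P x ->
  (forall z t, z \in W -> t \in W -> P z -> e z t -> P t) -> P y.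
Proof.
move=> cW xW yW Px step; have /connectP[p xp ->] := cW x y xW yW.
elim: p x xp xW Px => //= z p IHp x /andP[/and3P[xW zW exz] zp] _ Px.
by apply: IHp => //; apply: step Px exz.
Qed.

Lemma component_self (W : {set T}) x : x \in W -> x \in component W x.
Proof. by move=> xW; rewrite !inE xW connect0. Qed.

Lemma component_sub W x : component W x \subset W.
Proof. by apply/subsetP=> y; rewrite inE => /andP[]. Qed.

Lemma component_closed W x y z :
  y \in component W x -> z \in W -> e y z -> z \in component W x.
Proof.
rewrite !inE => /andP[yW xy] zW eyz; rewrite zW.
by apply: connect_trans xy _; apply: connect1; rewrite induced_relE yW zW.
Qed.

(** A walk in [W] starting in the component never leaves it, so it is also a walk of the graph
    induced on the component. *)
Lemma component_connected W x : connected (component W x).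
Proof.
have walk p y : path (induced_rel e W) y p -> y \in component W x ->
    connect (induced_rel e (component W x)) y (last y p).
  elim: p y => //= z p IHp y /andP[/and3P[yW zW eyz] zp] yC.
  have zC := component_closed yC zW eyz.
  apply: connect_trans (IHp _ zp zC).
  by apply: connect1; rewrite induced_relE yC zC.
suff from_x y : y \in component W x ->
    connect (induced_rel e (component W x)) x y.
  move=> u v /from_x xu /from_x xv.
  by apply: connect_trans xv; rewrite induced_connect_sym.
rewrite inE => /andP[yW /connectP[p xp def_y]]; rewrite def_y in yW *.
apply: (walk _ _ xp); apply: component_self.
by case: p xp yW {def_y} => //= z p /andP[/and3P[]].
Qed.

(** A walk with the fewest vertices works: a chord would give a shorter one. *)
Lemma connected_chordless_path (W : {set T}) x y :
  connected W -> x \in W -> y \in W ->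
  exists p, [/\ path e x p, last x p = y, {subset x :: p <= W},
                uniq (x :: p) & chordless (x :: p)].
Proof.
move=> cW xW yW.
pose P p := [/\ path e x p, last x p = y & {subset x :: p <= W}].
have [|p0 [[xp0 lp0 sp0] min_p0]] := @exists_minimizer _ size P.
  have /connectP[p xp def_y] := cW _ _ xW yW; exists p; split=> //.
    by apply: sub_path xp => u v /and3P[].
  move=> z; rewrite inE => /predU1P[-> //|].
  elim: p x xp {xW P def_y} => //= u p IHp x /andP[/and3P[_ uW _] up].
  by rewrite inE => /predU1P[-> //|]; apply: IHp up.
(* Removing repetitions keeps the walk minimal, which is recorded as a bound on its size. *)
have [p [[xp lp sp] up le_p]] :
    exists p, [/\ P p, uniq (x :: p) & size p <= size p0].
  move: lp0; case/shortenP: xp0 => p xp up sp lp; exists p; split.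
  - split=> // z; rewrite inE => /predU1P[-> //|/sp zp].
    by apply: sp0; rewrite inE zp orbT.
  - by [].
  - by case/andP: up => _ up; apply: uniq_leq_size.
exists p; split=> //.
move=> s1 z s2 def_p u v us1 vs2; apply/negP => euv.
case/splitPr: us1 def_p => r1 r2; case/splitPr: vs2 => r3 r4.
rewrite -!catA /= => def_p.
(* [q] is the walk shortened along the chord from [u] to [v]; [behead] drops the starting vertex
   [x], which heads the list whether or not [r1] is empty. *)
pose q := behead (r1 ++ u :: v :: r4).
have def_q : x :: q = r1 ++ u :: v :: r4.
  by rewrite /q; case: r1 def_p {q} => [|x' r1] [->].
have: size q < size p.
  have := congr1 size def_p; have := congr1 size def_q.
  by rewrite /= !size_cat /= !size_cat /= !size_cat /=; lia.
rewrite ltnNge (leq_trans le_p) // min_p0 //.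
have sq : sorted e (x :: q).
  have: sorted e (x :: p) by [].
  rewrite def_p def_q !sorted_cat_cons /= euv => /andP[-> ] /=.
  by rewrite cat_path /= cat_path => /and5P[].
split=> //.
- have := congr1 (last x) def_p; have := congr1 (last x) def_q.
  by rewrite !(last_cat, last_cons) lp => -> ->.
- move=> t; rewrite def_q => tq; apply: sp; rewrite def_p.
  by move: tq; rewrite !(mem_cat, inE) => /or4P[]->; rewrite ?orbT.
Qed.

(** * Holes *)

(** A neighbour of [z] further along the path would be joined to [z] by a chord over the first
    vertex of [s2]. *)
Lemma chordless_next s s1 z s2 y : chordless s -> s = s1 ++ z :: s2 ->
  y \in s2 -> e z y -> y = head z s2.
Proof.
case: s2 => // h s2 ch def_s; rewrite inE => /predU1P[//|ys2] ezy.
have def_s' : s = rcons s1 z ++ h :: s2 by rewrite cat_rcons.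
by have := ch _ _ _ def_s' z y; rewrite mem_rcons mem_head ezy => /(_ isT ys2).
Qed.

Lemma chordless_prev s s1 z s2 y : chordless s -> s = s1 ++ z :: s2 ->
  y \in s1 -> e z y -> y = last z s1.
Proof.
case/lastP: s1 => // s1 l ch; rewrite last_rcons cat_rcons => def_s.
rewrite mem_rcons inE => /predU1P[//|ys1] ezy.
by have := ch _ _ _ def_s y z ys1; rewrite mem_head e_sym ezy => /(_ isT).
Qed.

(** The successor and the predecessor of a vertex on the cycle are two distinct neighbours, so a
    vertex with at most two neighbours on the cycle has no chord. *)
Lemma hole_of_two_neighbours c : uniq c -> 3 < size c -> cycle e c ->
  {in c, forall x, exists n m, {in c, forall y, e x y -> y = n \/ y = m}} ->
  hole e c.
Proof.
move=> uc sz_c cyc nbr; split=> // x y xc yc.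
(* After rotating [z] to the front, its successor is the second entry and its predecessor the last
   one; these are different entries of a list without repetition. *)
have next_neq_prev z : z \in c -> next c z != prev c z.
  move=> zc; have [i s def_c] := rot_to zc.
  rewrite -(next_rot i) // -(prev_rot i) // def_c.
  have us : uniq (z :: s) by rewrite -def_c rot_uniq.
  have szs : 3 < size (z :: s) by rewrite -def_c size_rot.
  case: s us szs {def_c} => [|b [|d s]] // /and3P[zs bs _] _.
  rewrite [next _ _]/= eqxx; apply: contraNneq bs => ->.
  rewrite prev_nth mem_head memNindex //.
  rewrite -[size _]/(size [:: z, b, d & s]).-1 nth_last /=.
  exact: mem_last.
apply/idP/idP => [exy|]; last first.
  by case/orP=> /eqP<-; last rewrite e_sym; apply: next_cycle.
have [n [m nm]] := nbr x xc.
have := nm _ _ (next_cycle cyc xc); rewrite mem_next => /(_ xc) nx.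
have := nm (prev c x); rewrite mem_prev e_sym prev_cycle // => /(_ xc isT) px.
have /eqP np := next_neq_prev x xc.
have [y_next|y_prev] : y = next c x \/ y = prev c x.
  by case: (nm y yc exy) nx px => -> [] nx [] px; rewrite nx px in np *; auto.
- by rewrite y_next eqxx.
- by rewrite y_prev next_prev // eqxx orbT.
Qed.

Lemma hole_of_two_paths x y p q :
  path e x (rcons p y) -> path e x (rcons q y) ->
  uniq (x :: rcons p y) -> uniq (x :: rcons q y) ->
  chordless (x :: rcons p y) -> chordless (x :: rcons q y) ->
  p <> [::] -> q <> [::] ->
  {in p & q, forall z t, z != t /\ ~~ e z t} ->
  hole e (x :: p ++ y :: rev q).
Proof.
move=> xpy xqy up uq cp cq p0 q0 pq.
have memc z : (z \in x :: p ++ y :: rev q) =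
    (z \in x :: rcons p y) || (z \in q).
  by rewrite -cat_rcons -cat_cons mem_cat mem_rev.
have memcq z : (z \in x :: p ++ y :: rev q) =
    (z \in x :: rcons q y) || (z \in p).
  by rewrite memc !(inE, mem_rcons); do !case: (_ == _) => //=; rewrite orbC.
apply: hole_of_two_neighbours.
- rewrite -cat_rcons -cat_cons cat_uniq up rev_uniq /=.
  move: uq; rewrite cons_uniq rcons_uniq mem_rcons inE negb_or.
  case/and3P=> /andP[xy xq] yq ->; rewrite andbT.
  apply/hasPn=> z; rewrite mem_rev => zq; rewrite inE mem_rcons inE !negb_or.
  have z_ne t : t \notin q -> z != t by apply: contraNneq => <-.
  rewrite !z_ne //=; apply/negP=> zp.
  by have [] := pq z z zp zq; rewrite eqxx.
- rewrite /= size_cat /= size_rev.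
  case: p p0 {xpy up cp pq memc memcq} => //.
  by case: q q0 {xqy uq cq} => //=; lia.
- rewrite /cycle rcons_cat /= -cat_rcons cat_path xpy last_rcons /=.
  have := rev_path e x (rcons q y); rewrite last_rcons belast_rcons rev_cons => ->.
  by rewrite (eq_path (e' := e)) // => u v; rewrite e_sym.
(* An interior vertex of one path sees only the vertices before and after it on that path, and
   nothing inside the other path. *)
have inner (r r' : seq T) : chordless (x :: rcons r y) ->
    {in r & r', forall z t, ~~ e z t} -> {in r, forall z, exists n m,
    {in [predU (x :: rcons r y) & r'], forall t, e z t -> t = n \/ t = m}}.
  move=> cr rr' z /[dup] zr; case/splitPr: zr cr rr' => r1 r2 cr rr' zr.
  exists (head z (rcons r2 y)), (last z (x :: r1)) => t.
  have def_s : x :: rcons (r1 ++ z :: r2) y = (x :: r1) ++ z :: rcons r2 y.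
    by rewrite /= rcons_cat.
  rewrite inE /= => /orP[]; last by move=> tr'; rewrite (negPf (rr' _ _ zr tr')).
  rewrite def_s mem_cat inE => /or3P[ts ezt|/eqP-> |ts ezt].
  - by right; apply: chordless_prev cr def_s ts ezt.
  - by rewrite e_irr.
  - by left; apply: chordless_next cr def_s ts ezt.
have pqN : {in p & q, forall z t, ~~ e z t} by move=> z t zp tq; case: (pq z t).
have qpN : {in q & p, forall z t, ~~ e z t}.
  by move=> z t zq tp; rewrite e_sym; apply: pqN.
have ends r t : chordless (x :: rcons r y) -> t \in x :: rcons r y ->
    (e x t -> t = head x (rcons r y)) /\ (e y t -> t = last y (x :: r)).
  move=> cr tr; split=> ext.
    apply: (@chordless_next _ [::] x _ _ cr) => //.
    by move: tr; rewrite inE => /predU1P[tx|//]; rewrite tx e_irr in ext.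
  apply: (@chordless_prev _ _ y [::] _ cr); rewrite ?cats1 //.
  move: tr; rewrite -rcons_cons mem_rcons inE => /predU1P[tx|//].
  by rewrite tx e_irr in ext.
move=> z; rewrite memc inE mem_rcons inE -!orbA => /or4P[/eqP->|/eqP->|zp|zq].
- exists (head x (rcons p y)), (head x (rcons q y)) => t.
  rewrite memc => /orP[tp|tq] ext; first by left; apply: (proj1 (ends p t cp tp)).
  right; apply: (proj1 (ends q t cq _)) => //.
  by rewrite inE mem_rcons inE tq !orbT.
- exists (last y (x :: p)), (last y (x :: q)) => t.
  rewrite memc => /orP[tp|tq] ext; first by left; apply: (proj2 (ends p t cp tp)).
  right; apply: (proj2 (ends q t cq _)) => //.
  by rewrite inE mem_rcons inE tq !orbT.
- have [n [m nm]] := inner p q cp pqN z zp; exists n, m => t.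
  by rewrite memc => tc; apply: nm; rewrite inE.
- have [n [m nm]] := inner q p cq qpN z zq; exists n, m => t.
  by rewrite memcq => tc; apply: nm; rewrite inE.
Qed.

(** * Holes in triangle-free sparse graphs *)

Hypotheses (e_tf : triangle_free e) (e_sparse : sparse e).

Lemma no_triangle x y z : e x y -> e y z -> ~~ e x z.
Proof. by move=> xy yz; apply/negP=> xz; apply: e_tf; exists x, y, z. Qed.

(** Sparsity confines the neighbours of [z] on the hole to the ends of one edge, and [z] cannot see
    both ends without forming a triangle. *)
Lemma hole_one_neighbour c z p q : hole e c -> z \notin c ->
  p \in c -> q \in c -> e z p -> e z q -> p = q.
Proof.
move=> hc zc pc qc zp zq; have [s [t [sc tc st /subsetP nb]]] := e_sparse hc zc.
have nbst r : r \in c -> e z r -> r = s \/ r = t.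
  by move=> rc zr; have := nb r; rewrite !inE rc zr => /(_ isT) /orP[] /eqP; auto.
have Nst : ~ (e z s /\ e z t).
  by case=> zs zt; have := no_triangle zs st; rewrite zt.
by case: (nbst p pc zp) (nbst q qc zq) => [ps|pt] [qs|qt]; subst=> //; case: Nst.
Qed.

(* For nonadjacent x and y this amounts to a hole through x and y inside
   W1 :|: W2 :|: [set x; y]. *)
Definition links (x y : T) (W1 W2 : {set T}) : Prop :=
  [/\ connected W1 /\ connected W2,
      [disjoint W1 & W2] /\ anticomplete W1 W2,
      touches x W1 /\ touches x W2,
      touches y W1 /\ touches y W2 &
      [/\ x \notin W1, x \notin W2, y \notin W1 & y \notin W2]].

Definition induced_link (x y : T) (p : seq T) : Prop :=
  [/\ path e x (rcons p y), uniq (x :: rcons p y),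
      chordless (x :: rcons p y) & p <> [::]].

(** Take a chordless path from [x] to [y] in [W] together with both ends. It has an interior because
    [x] and [y] are distinct and nonadjacent. *)
Lemma connected_induced_link (W : {set T}) x y : connected W ->
  touches x W -> touches y W -> x \notin W -> y \notin W ->
  x != y -> ~~ e x y ->
  exists2 p, {subset p <= W} & induced_link x y p.
Proof.
move=> cW xW yW xNW yNW xy Nexy.
have cWxy : connected (x |: (y |: W)).
  apply: connectedU1; first exact: connectedU1.
  exact: touchesS (subsetUr _ _) xW.
have [||s [xs ls sW us cs]] := @connected_chordless_path _ x y cWxy;
  rewrite ?inE ?eqxx ?orbT //.
case/lastP: s xs ls sW us cs => [_ /= xy0|p y'].
  by rewrite xy0 eqxx in xy.
rewrite last_rcons => xp def_y; rewrite {}def_y {y'} in xp *; move=> pW up cp.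
exists p; last split=> //.
  move=> z zp; have := pW z; rewrite !inE mem_rcons inE zp !orbT => /(_ isT).
  move: up; rewrite /= mem_rcons rcons_uniq inE negb_or => /and3P[/andP[_ xp'] yp _].
  by case/or3P=> // /eqP zE; rewrite -zE zp in xp' yp.
by move=> p0; move: xp; rewrite p0 /= andbT; apply/negP.
Qed.

Lemma links_hole x y W1 W2 : links x y W1 W2 -> x != y -> ~~ e x y ->
  exists p q, [/\ {subset p <= W1}, {subset q <= W2}, induced_link x y p,
                  induced_link x y q & hole e (x :: p ++ y :: rev q)].
Proof.
case=> [[c1 c2] [dis anti] [x1 x2] [y1 y2] [xN1 xN2 yN1 yN2]] xy Nxy.
have [p pW lp] := connected_induced_link c1 x1 y1 xN1 yN1 xy Nxy.
have [q qW lq] := connected_induced_link c2 x2 y2 xN2 yN2 xy Nxy.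
exists p, q; split=> //; case: lp lq => [xp up cp p0] [xq uq cq q0].
apply: hole_of_two_paths => // z t /pW zW /qW tW; split; last exact: anti.
by apply: contraTneq tW => <-; rewrite (disjointFr dis zW).
Qed.

(** The vertex [z] would have two neighbours on a hole that avoids it. Contradictions from sparsity
    are mostly drawn in this form, without constructing the hole. *)
Lemma links_no_common_neighbour x y z W1 W2 : links x y W1 W2 -> x != y ->
  e z x -> e z y -> z \notin W1 -> z \notin W2 -> False.
Proof.
move=> lk xy zx zy zN1 zN2.
have Nxy : ~~ e x y by apply: no_triangle zy; rewrite e_sym.
have [p [q [pW qW _ _ hc]]] := links_hole lk xy Nxy.
have zc : z \notin x :: p ++ y :: rev q.
  rewrite !(inE, mem_cat) mem_rev !negb_or.
  rewrite (contra (@pW z)) // (contra (@qW z)) // andbT /=.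
  by apply/andP; split; [apply: contraTneq zx|apply: contraTneq zy] => ->;
    rewrite e_irr.
case/eqP: xy; apply: (hole_one_neighbour hc zc) => //.
  by rewrite mem_head.
by rewrite !(inE, mem_cat) eqxx !orbT.
Qed.

(** * Graphs without clique cutsets *)

(** The clique [K] may be empty, so the condition includes connectedness of the graph induced on
    [S]. *)
Definition no_clique_cutset (S : {set T}) : Prop :=
  forall K X : {set T}, K \subset S -> clique e K -> X \subset S :\: K ->
  X != set0 -> S :\: K :\: X != set0 -> ~ anticomplete X (S :\: K :\: X).

Definition nonnbrs (S : {set T}) (c : T) : {set T} := S :\: (c |: nbh e c).

Lemma in_nonnbrs S c x :
  (x \in nonnbrs S c) = [&& x \in S, x != c & ~~ e c x].
Proof. by rewrite !inE negb_or andbC. Qed.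

(* A component M1 of the nonneighbours of c and a connected set W in the rest
   share at most one neighbour x of c, since two would lie in a common hole;
   then {c, x} is a clique cutset. *)
Lemma nonnbrs_connected S c :
  no_clique_cutset S -> c \in S -> connected (nonnbrs S c).
Proof.
move=> ncS cS m z mM zM; apply: contraT => Nmz; exfalso.
pose M1 := component (nonnbrs S c) m.
have mM1 : m \in M1 by apply: component_self.
have zM1 : z \notin M1 by rewrite inE zM.
have M1M y : y \in M1 -> y \in nonnbrs S c by apply/subsetP/component_sub.
(* [N1] is where [M1] attaches to the neighbourhood of [c]. Its members that also see the component
   [W] form the set [X] below. *)
pose N1 := [set x in S | e c x && [exists y in M1, e x y]].
pose W := component (S :\ c :\: M1 :\: N1) z.
have zW : z \in W.
  apply: component_self; move: zM; rewrite in_nonnbrs => /and3P[zS zc Ncz].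
  by rewrite 2!in_setD zM1 in_setD1 zc zS inE (negPf Ncz) andbF.
have inW y : y \in W -> [/\ y \in S, y != c, y \notin M1 & y \notin N1].
  move/(subsetP (component_sub _ _)).
  by rewrite 2!in_setD in_setD1 => /and4P[? ? ? ?].
have M1W : anticomplete M1 W.
  move=> y x yM1 /inW[xS xc xM1 xN1]; apply: contra xM1 => eyx.
  have Ncx : ~~ e c x.
    apply: contra xN1 => ecx; rewrite inE xS ecx; apply/existsP; exists y.
    by rewrite yM1 e_sym.
  by apply: component_closed yM1 _ eyx; rewrite in_nonnbrs xS xc.
pose X := [set x in N1 | [exists y in W, e x y]].
have X_one x x' : x \in X -> x' \in X -> x = x'.
  rewrite !inE -!andbA => /and4P[xS cx /exists_inP[y1 y1M xy1] /exists_inP[t1 t1W xt1]].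
  case/and4P=> [x'S cx' /exists_inP[y2 y2M xy2] /exists_inP[t2 t2W xt2]].
  apply/eqP/negPn/negP => xx'.
  have N1P w y : w \in S -> e c w -> y \in M1 -> e w y -> (w \notin M1) /\ (w \notin W).
    move=> wS cw yM1 wy; split; apply/negP.
      by move/M1M; rewrite in_nonnbrs cw !andbF.
    case/inW=> _ _ _; rewrite inE wS cw => /negP[]; apply/existsP; exists y.
    by rewrite yM1.
  have [xN1 xN2] := N1P _ _ xS cx y1M xy1.
  have [x'N1 x'N2] := N1P _ _ x'S cx' y2M xy2.
  apply: (@links_no_common_neighbour x x' c M1 W) => //.
  - split=> //.
    + by split; apply: component_connected.
    + split=> //; rewrite disjoint_subset; apply/subsetP=> y yM1.
      by apply/negP=> /inW[]; rewrite yM1.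
    + by split; [exists y1|exists t1].
    + by split; [exists y2|exists t2].
  - by apply/negP=> /M1M; rewrite in_nonnbrs eqxx andbF.
  - by apply/negP=> /inW[]; rewrite eqxx.
have inX x : x \in X -> x \in S /\ e c x by rewrite !inE => /andP[/and3P[]].
apply: (ncS (c |: X) W).
- by apply/subsetP=> x /setU1P[->|/inX[]].
- move=> x y /setU1P[->|xX] /setU1P[->|yX]; rewrite ?eqxx //.
  + by case: (inX _ yX).
  + by rewrite e_sym; case: (inX _ xX).
  + by rewrite (X_one x y) // eqxx.
- apply/subsetP=> x xW; have [xS xc xM1 xN1] := inW x xW.
  by rewrite in_setD xS in_setU1 negb_or xc inE (negPf xN1).
- by apply/set0Pn; exists z.
- apply/set0Pn; exists m; have := mM; rewrite in_nonnbrs => /and3P[mS mc Ncm].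
  rewrite 2!in_setD mS in_setU1 negb_or mc andbT; apply/andP; split.
    by apply/negP=> /inW[]; rewrite mM1.
  by apply/negP=> /inX[]; rewrite (negPf Ncm).
- move=> x y xW; rewrite 2!in_setD in_setU1 negb_or => /and3P[yW /andP[yc yX] yS].
  apply/negP=> exy; have yM1 : y \notin M1.
    by apply/negP=> yM1; have := M1W y x yM1 xW; rewrite e_sym exy.
  have yN1 : y \notin N1.
    apply: contra yX => yN1; rewrite inE yN1; apply/existsP; exists x.
    by rewrite xW e_sym.
  case/negP: yW; apply: component_closed xW _ exy.
  by rewrite 2!in_setD in_setD1 yN1 yM1 yc.
Qed.

(** Any neighbour of [x] in [S] other than [c] is a nonneighbour of [c], since there are no
    triangles. Without one, the clique [[set c]] would cut [x] off from [z]. *)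
Lemma neighbour_touches_nonnbrs S c x z : no_clique_cutset S ->
  c \in S -> x \in S -> e c x -> z \in nonnbrs S c ->
  touches x (nonnbrs S c).
Proof.
move=> ncS cS xS cx zM; apply: NNPP => Ntouch.
have xc : x != c by apply: contraTneq cx => ->; rewrite e_irr.
apply: (ncS [set c] [set x]).
- by rewrite sub1set.
- by move=> ? ? /set1P-> /set1P->; rewrite eqxx.
- by rewrite sub1set !inE xc.
- by apply/set0Pn; exists x; rewrite set11.
- move: zM; rewrite in_nonnbrs => /and3P[zS zc Ncz].
  apply/set0Pn; exists z; rewrite !inE zS zc !andbT.
  by apply: contraNneq Ncz => ->.
- move=> ? y /set1P->; rewrite !inE => /and3P[_ yc yS]; apply/negP=> xy.
  apply: Ntouch; exists y => //; rewrite in_nonnbrs yS yc.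
  exact: no_triangle cx xy.
Qed.

(** * Moving a hole through [a] along an edge *)

Definition linked (S : {set T}) (x y : T) : Prop :=
  exists W1 W2 : {set T}, [/\ W1 \subset S, W2 \subset S & links x y W1 W2].

(** Otherwise the neighbourhood of [a] in [S] has at most one vertex, hence is a clique that cuts
    [a] off from [u]. *)
Lemma two_neighbours S a u : no_clique_cutset S -> a \in S ->
  u \in nonnbrs S a ->
  exists x1 x2, [/\ x1 \in S, x2 \in S, x1 != x2, e a x1 & e a x2].
Proof.
move=> ncS aS; rewrite in_nonnbrs => /and3P[uS ua Nau].
case: (ltnP 1 #|nbh e a :&: S|) => [/card_gt1P[x1 [x2 [x1N x2N x12]]]|le1].
  by move: x1N x2N; rewrite !inE => /andP[? ?] /andP[? ?]; exists x1, x2.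
exfalso; apply: (ncS (nbh e a :&: S) [set a]).
- exact: subsetIr.
- move=> x y xN yN; have /card_le1P le := le1.
  by have := le x xN y; rewrite yN inE => /esym /eqP->; rewrite eqxx.
- by rewrite sub1set !inE e_irr.
- by apply/set0Pn; exists a; rewrite set11.
- by apply/set0Pn; exists u; rewrite !inE ua uS (negPf Nau).
- move=> ? y /set1P->; rewrite !inE => /and3P[_ + yS].
  by rewrite yS andbT.
Qed.

(** Two neighbours [x1], [x2] of [a] are joined by a chordless path through the nonneighbours of
    [a], which closes up with [a] to a hole. The first inner vertex [d] of that path is linked to
    [a] by [x1] on one side and by the rest of the path on the other. *)
Lemma linked_start S a u : no_clique_cutset S -> a \in S ->
  u \in nonnbrs S a -> exists2 d, d \in nonnbrs S a & linked S a d.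
Proof.
move=> ncS aS uM.
have [x1 [x2 [x1S x2S x12 ax1 ax2]]] := two_neighbours ncS aS uM.
have NM x : e a x -> x \notin nonnbrs S a.
  by move=> ax; rewrite in_nonnbrs ax !andbF.
have aM : a \notin nonnbrs S a by rewrite in_nonnbrs eqxx andbF.
have Nx12 : ~~ e x1 x2 by apply: no_triangle ax2; rewrite e_sym.
have [p pM] := connected_induced_link (nonnbrs_connected ncS aS)
  (neighbour_touches_nonnbrs ncS aS x1S ax1 uM)
  (neighbour_touches_nonnbrs ncS aS x2S ax2 uM) (NM _ ax1) (NM _ ax2) x12 Nx12.
case: p pM => [|d p] pM [xp up cp p0] //.
have dM : d \in nonnbrs S a by apply: pM; rewrite mem_head.
exists d => //; exists [set x1], [set z in rcons p x2].
have MS x : x \in nonnbrs S a -> x \in S by rewrite in_nonnbrs => /and3P[].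
move: xp up cp; rewrite rcons_cons /= => /andP[x1d dp] /and3P[x1N dN _] cp.
have def_s : exists h s, rcons p x2 = h :: s.
  by case: (p) => [|h s]; [exists x2, [::]|exists h, (rcons s x2)].
split.
- by rewrite sub1set.
- apply/subsetP=> z; rewrite inE mem_rcons inE => /predU1P[-> //|zp].
  by apply/MS/pM; rewrite inE zp orbT.
- move: x1N; rewrite inE negb_or => /andP[x1d' x1N]; split.
  + split; first exact: connected1.
    by case: def_s dp => h [s ->]; apply: connected_behead_path.
  + split.
      by rewrite disjoints1 inE.
    move=> ? z /set1P->; rewrite inE => zs.
    by apply: (cp [:: x1] d _ erefl) => //; rewrite mem_head.
  + split; first by exists x1; rewrite // set11.
    by exists x2 => //; rewrite inE mem_rcons mem_head.
  + split; first by exists x1; rewrite ?set11 // e_sym.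
    by case: def_s dp => h [s ->] /= /andP[dh _]; exists h; rewrite // inE mem_head.
  + split; rewrite ?inE //.
    * by apply: contraTneq ax1 => ->; rewrite e_irr.
    * rewrite mem_rcons inE negb_or; apply/andP; split.
        by apply: contraTneq ax2 => ->; rewrite e_irr.
      by apply: contra aM => ap; apply: pM; rewrite inE ap orbT.
    * by rewrite eq_sym.
Qed.

(** This isolates the end of an arc at [c]: [c1] is the only vertex before [c] that [c] sees. The
    remainder [p'] may be empty, in which case [last a p'] is [a]. *)
Lemma induced_link_first_last a c p : induced_link a c p ->
  exists p' c1, [/\ p = rcons p' c1, e c c1,
    {in a :: p, forall z, e c z -> z = c1}, path e a p' /\ e (last a p') c1 &
    c1 \notin a :: p'].
Proof.
case=> ap up cp; case/lastP: p ap up cp => // p c1 ap up cp _; exists p, c1.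
move: ap; rewrite !rcons_path last_rcons => /andP[/andP[ap pc1] c1c].
split=> //; rewrite 1?e_sym //.
  move=> z zp cz; have := @chordless_prev _ (a :: rcons p c1) c [::] z cp.
  by rewrite cats1 => /(_ erefl zp cz); rewrite /= last_rcons.
move: up; rewrite -!rcons_cons !rcons_uniq => /and3P[_ //].
Qed.

Lemma induced_link_connected a c p : induced_link a c p ->
  [/\ connected [set z in p], touches a [set z in p], touches c [set z in p],
      a \notin p & c \notin p].
Proof.
move=> lp; have [p' [c1 [def_p cc1 _ _ _]]] := induced_link_first_last lp.
case: lp => ap up _ p0.
move: up; rewrite cons_uniq rcons_uniq mem_rcons inE negb_or.
case/and3P=> /andP[_ ->] -> _; split=> //.
- move: ap; rewrite rcons_path => /andP[+ _].
  by case: (p) p0 => // h s _; apply: connected_behead_path.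
- by case: (p) p0 ap => // h s _ /= /andP[ah _]; exists h; rewrite // inE mem_head.
- by exists c1; rewrite // def_p inE mem_rcons mem_head.
Qed.

(** The arc from [a] through [q] to [c] is kept and prolonged to [u] by the edge from [c]; [W]
    supplies the other side of the new hole. *)
Lemma linked_detour (S W : {set T}) a c u q :
  induced_link a c q -> {subset q <= S} -> c \in S -> W \subset S ->
  connected W -> anticomplete (c |: [set z in q]) W ->
  [disjoint c |: [set z in q] & W] -> touches a W -> touches u W ->
  e u c -> u \notin c :: q -> u \notin W -> a != c -> a \notin W ->
  linked S a u.
Proof.
move=> lq qS cS WS cW anti dis aW uW uc uNq uNW ac aNW.
have [cq aq cq' aNq cNq] := induced_link_connected lq.
exists (c |: [set z in q]), W; split=> //.
  by apply/subsetP=> z; rewrite !inE => /predU1P[->//|]; apply: qS.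
split=> //.
- by split=> //; apply: connectedU1.
- by split=> //; apply: touchesS (subsetUr _ _) aq.
- by split=> //; exists c; rewrite // setU11.
- by move: uNq; rewrite inE => uNq; split; rewrite ?inE // negb_or ac.
Qed.

(* If z is the first vertex of the path s that sees d1, then c and z are linked
   by the part of s before z and, via L and d2, by the part after z, although d1
   is adjacent to both. *)
Lemma no_first_attachment (L : {set T}) c d1 d2 u s1 z s2 :
  path e u (s1 ++ z :: s2) -> uniq (u :: s1 ++ z :: s2) ->
  chordless (u :: s1 ++ z :: s2) ->
  s2 <> [::] -> touches (last z s2) L -> connected L -> touches d2 L ->
  e c d1 -> e c d2 -> e c u -> e d1 z -> d1 != d2 ->
  c \notin L -> d1 \notin L ->
  {in u :: s1 ++ z :: s2, forall y,
     [/\ y != c, y != d1, y != d2 & y \notin L]} ->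
  {in u :: s1, forall y, ~~ e d2 y /\ ~ touches y L} -> False.
Proof.
move=> up uu cu s20 tL cL d2L cd1 cd2 cu' d1z d12 cNL d1NL sN s1N.
have cd x : e c x -> c != x by apply: contraTneq => <-; rewrite e_irr.
have s_mem y : y \in u :: s1 \/ y \in s2 -> y \in u :: s1 ++ z :: s2.
  by rewrite -cat_cons mem_cat [y \in z :: _]inE; case=> ->; rewrite ?orbT.
have [zc zd1 zd2 zL] : [/\ z != c, z != d1, z != d2 & z \notin L].
  by apply: sN; rewrite -cat_cons mem_cat mem_head orbT.
move: up; rewrite cat_path /= => /and3P[us1 s1z zs2].
move: (uu); rewrite -cat_cons cat_uniq => /and3P[_ /hasPn us12 /=/andP[zs2' _]].
have d1c : e d1 c by rewrite e_sym.
have cz : c != z by rewrite eq_sym.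
apply: (@links_no_common_neighbour c z d1 [set y in u :: s1]
  ([set y in s2] :|: (d2 |: L))) => //.
- split.
  + split; first exact: connected_path.
    case: s2 s20 tL zs2 {uu cu sN s_mem us12 zs2'} => // h s2 _ [y yL ty] zs2.
    apply: (@connectedU _ _ (last h s2) y) => //.
    * exact: connected_behead_path zs2.
    * exact: connectedU1.
    * by rewrite inE mem_last.
    * by rewrite inE yL orbT.
  + split.
      rewrite disjoint_subset; apply/subsetP=> y; rewrite inE => ys.
      have [_ _ yd2 yL] := sN y (s_mem _ (or_introl ys)).
      rewrite !inE !negb_or yd2 yL !andbT; apply/negP=> ys2.
      by have := us12 y; rewrite inE ys2 orbT ys => /(_ isT).
    move=> y y'; rewrite inE => ys; have [Nd2y NyL] := s1N y ys.
    rewrite !inE => /or3P[y's|/eqP->|y'L].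
    * by apply: (cu (u :: s1) z s2).
    * by rewrite e_sym.
    * by apply/negP=> yy'; apply: NyL; exists y'.
  + split; first by exists u; rewrite // inE mem_head.
    by exists d2; rewrite // !inE eqxx orbT.
  + split; first by exists (last u s1); [rewrite inE mem_last|rewrite e_sym].
    case: s2 s20 zs2 {uu cu sN s_mem us12 zs2' tL} => // h s2 _ /= /andP[zh _].
    by exists h; rewrite // !inE eqxx.
  + have Nc y : y \in u :: s1 \/ y \in s2 -> y != c by move/s_mem/sN=> [].
    split.
    * by rewrite in_set; apply/negP=> cs; have := Nc c (or_introl cs); rewrite eqxx.
    * rewrite in_setU in_setU1 in_set !negb_or cd // cNL !andbT.
      by apply/negP=> cs; have := Nc c (or_intror cs); rewrite eqxx.
    * by rewrite in_set; apply: us12; rewrite mem_head.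
    * by rewrite in_setU in_setU1 in_set !negb_or zs2' zd2.
- apply/negP; rewrite in_set => d1s.
  by have [_] := sN d1 (s_mem _ (or_introl d1s)); rewrite eqxx.
- rewrite in_setU in_setU1 in_set !negb_or d12 d1NL !andbT; apply/negP=> d1s.
  by have [_] := sN d1 (s_mem _ (or_intror d1s)); rewrite eqxx.
Qed.

(* Let C be a hole through a and c, with neighbours c1, c2 of c on C, and let
   u not lie on C.  A shortest path that starts at u, avoids the other
   neighbours of c and ends at a neighbour t of L = C - {c, c1, c2} does not see
   c1 or c2, so it replaces one of the two arcs of C between c and a. *)
Lemma linked_step S a c u : no_clique_cutset S -> a \in S ->
  c \in nonnbrs S a -> u \in nonnbrs S a -> e c u ->
  linked S a c -> linked S a u.
Proof.
move=> ncS aS; rewrite 2!in_nonnbrs => /and3P[cS ca Nac] /and3P[uS ua Nau] cu.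
case=> W1 [W2 [/subsetP W1S /subsetP W2S lk]].
have ac : a != c by rewrite eq_sym.
have Nca : ~~ e c a by rewrite e_sym.
have uc : e u c by rewrite e_sym.
have u_c : u != c by apply: contraTneq cu => ->; rewrite e_irr.
have [p [q [pW qW lp lq hc]]] := links_hole lk ac Nac.
have pS : {subset p <= S} by move=> z /pW /W1S.
have qS : {subset q <= S} by move=> z /qW /W2S.
have pq : {in p & q, forall z t, z != t /\ ~~ e z t}.
  case: lk => _ [dis anti] _ _ _ z t /pW zW /qW tW; split; last exact: anti.
  by apply: contraTneq tW => <-; rewrite (disjointFr dis zW).
have qp : {in q & p, forall z t, z != t /\ ~~ e z t}.
  by move=> z t zq tp; rewrite eq_sym e_sym; apply: pq.
have [_ _ _ aNp cNp] := induced_link_connected lp.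
have [_ _ _ aNq cNq] := induced_link_connected lq.
pose C := a :: p ++ c :: rev q.
have memC z : (z \in C) = [|| z == a, z == c, z \in p | z \in q].
  by rewrite !(inE, mem_cat) mem_rev; do !case: (_ == _); rewrite ?orbT //=.
(* Common form of the two arcs of the hole between [a] and [c], which lets each argument below be
   run for either arc. *)
pose side r r' d := [/\ r = rcons r' d, e c d,
  {in a :: r, forall z, e c z -> z = d}, path e a r' /\ e (last a r') d &
  d \notin a :: r'].
have [p' [c1 sp]] : exists p' c1, side p p' c1.
  exact: induced_link_first_last lp.
have [q' [c2 sq]] : exists q' c2, side q q' c2.
  exact: induced_link_first_last lq.
(* If [u] is on the hole it is the neighbour [d] of [c] on one arc, and the same hole links [a] to
   [u]: [r'] is one side, [c] with the other arc the second. *)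
have inner r r' d s : side r r' d -> induced_link a c s -> c \notin r ->
    a \notin r -> {in s & r, forall z t, z != t /\ ~~ e z t} ->
    {subset r <= S} -> {subset s <= S} -> u \in r -> linked S a u.
  case=> def_r cd cr [ar' r'd] dN ls cNr aNr sr rS sS ur.
  have ud : u = d by apply: cr; rewrite // inE ur orbT.
  have r'r z : z \in r' -> z \in r by rewrite def_r mem_rcons inE => ->; rewrite orbT.
  have [h [r2 def_r']] : exists h r2, r' = h :: r2.
    case: (r') r'd => [|h r2 _]; last by exists h, r2.
    by rewrite /= -ud (negPf Nau).
  apply: (@linked_detour S [set z in r'] a c u s) => //.
  - by apply/subsetP=> z; rewrite inE => /r'r /rS.
  - by rewrite def_r' in ar' *; apply: connected_behead_path ar'.
  - move=> z t; rewrite !inE => /predU1P[-> tr'|zs tr'].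
      apply/negP=> ct; case/negP: dN; rewrite -(cr t) ?inE ?tr' ?orbT //.
      by rewrite r'r ?orbT.
    by have [] := sr z t zs (r'r _ tr').
  - rewrite disjoint_subset; apply/subsetP=> z; rewrite !inE => /predU1P[->|zs].
      by apply: contra cNr => /r'r.
    by apply/negP=> /r'r zr; have [] := sr z z zs zr; rewrite eqxx.
  - exists h; first by rewrite def_r' inE mem_head.
    by move: ar'; rewrite def_r' /= => /andP[].
  - exists (last a r'); last by rewrite e_sym ud.
    by rewrite def_r' last_cons inE mem_last.
  - rewrite inE negb_or u_c /=; apply/negP=> us.
    by have [] := sr u u us ur; rewrite eqxx.
  - by rewrite inE ud; apply: contra dN; rewrite inE => ->; rewrite orbT.
  - by rewrite inE; apply: contra aNr => /r'r.
have [uC|uC] := boolP (u \in C).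
  move: uC; rewrite memC (negPf ua) (negPf u_c) /= => /orP[up|uq].
    exact: inner sp lq cNp aNp qp pS qS up.
  exact: inner sq lp cNq aNq pq qS pS uq.
have uC1 z : z \in C -> e u z -> z = c.
  move=> zC uz; apply: (hole_one_neighbour hc uC) => //.
  by rewrite -/C memC eqxx orbT.
pose L := [set z in a :: p'] :|: [set z in a :: q'].
have aL : a \in L by rewrite !inE eqxx.
have p'p z : z \in p' -> z \in p.
  by case: sp => -> _ _ _ _; rewrite mem_rcons inE => ->; rewrite orbT.
have q'q z : z \in q' -> z \in q.
  by case: sq => -> _ _ _ _; rewrite mem_rcons inE => ->; rewrite orbT.
have LC z : z \in L -> z \in C.
  by rewrite memC !inE -!orbA => /or4P[->|/p'p->|->|/q'q->]; rewrite ?orbT.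
have LM z : z \in L -> z \in nonnbrs S c.
  have asub r r' d : side r r' d -> c \notin r -> {subset r <= S} ->
      z \in a :: r' -> z \in nonnbrs S c.
    case=> def_r cd cr _ dN cNr rS zr'.
    have zr : z \in a :: r.
      by move: zr'; rewrite def_r !inE mem_rcons inE => /orP[]->; rewrite ?orbT.
    rewrite in_nonnbrs; apply/and3P; split.
    - by move: zr; rewrite inE => /predU1P[->|/rS].
    - by move: zr; rewrite inE => /predU1P[->//|]; apply: contraTneq => ->.
    - by apply/negP=> cz; rewrite (cr z zr cz) (negPf dN) in zr'.
  case/setUP; rewrite [X in is_true X -> _]in_set.
    exact: (asub _ _ _ sp cNp pS).
  exact: (asub _ _ _ sq cNq qS).
have cL : connected L.
  case: sp sq => _ _ _ [ap' _] _ [_ _ _ [aq' _] _].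
  by apply: (@connectedUI _ _ a); rewrite ?in_set ?mem_head //; apply: connected_path.
pose M := u |: nonnbrs S c.
have aM : a \in nonnbrs S c by apply: LM.
have cM : connected M.
  apply: connectedU1; first exact: nonnbrs_connected.
  exact: neighbour_touches_nonnbrs aM.
pose NL := [set x | [exists y in L, e x y]].
have NLP x : reflect (touches x L) (x \in NL).
  by rewrite inE; apply: (iffP exists_inP).
have uNL : u \notin NL.
  apply/NLP=> [[y yL uy]]; have yc := uC1 _ (LC _ yL) uy.
  by have := LM _ yL; rewrite in_nonnbrs yc eqxx andbF.
have uL : u \notin L by apply: contra uC => /LC.
(* [Q] is what can be reached from [u] in [M] before meeting [L] or a vertex that sees [L]. *)
pose Q := component (M :\: L :\: NL) u.
have uQ : u \in Q.
  by apply: component_self; rewrite 2!in_setD uNL uL setU11.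
have QP z : z \in Q -> [/\ z \in M, z \notin L & z \notin NL].
  by move/(subsetP (component_sub _ _)); rewrite 2!in_setD => /and3P[].
(* If no such [t] existed, [Q] would absorb all of the connected set [M], although [M] contains the
   vertex [a] of [L]. *)
have [t [tM tL tNL tQ]] : exists t,
    [/\ t \in nonnbrs S c, t \notin L, t \in NL & touches t Q].
  apply: NNPP => no_t.
  suff /QP[_]: a \in Q by rewrite aL.
  apply: (@connected_ind M (fun z => z \in Q) u a) => //.
  - by rewrite setU11.
  - by rewrite in_setU1 aM orbT.
  move=> x y xM yM xQ xy; have [_ _ xNL] := QP x xQ.
  have yL : y \notin L by apply/negP=> yL; case/NLP: xNL; exists y.
  have yNL : y \notin NL.
    apply/negP=> yNL; apply: no_t; exists y; split=> //; last by exists x; rewrite // e_sym.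
    by move: yM; rewrite in_setU1 => /predU1P[yu|//]; rewrite yu (negPf uNL) in yNL.
  by apply: component_closed xQ _ xy; rewrite 2!in_setD yNL yL.
have tQ' : connected (t |: Q) by apply: connectedU1 => //; apply: component_connected.
(* On this path only the last vertex [t] has neighbours in [L], as all the others belong to [Q]. *)
have [||s [us ls sQ uniq_s chs]] := @connected_chordless_path _ u t tQ'.
- by rewrite in_setU1 uQ orbT.
- by rewrite setU11.
have tu : t != u by apply: contraTneq tNL => ->.
have sM z : z \in u :: s -> [/\ z \in M & z \notin L].
  by move/sQ; rewrite in_setU1 => /predU1P[->|/QP[]//]; rewrite in_setU1 tM orbT.
have sC z : z \in u :: s -> z \notin C.
  move=> zs; have [] := sM z zs; rewrite in_setU1 => /predU1P[->//|zM] zL.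
  move: zM; rewrite in_nonnbrs => /and3P[_ zc Ncz].
  rewrite memC (negPf zc) !negb_or /=.
  case: sp sq zL => -> cc1 _ _ _ [-> cc2 _ _ _].
  rewrite !(inE, mem_rcons) !negb_or => /andP[/andP[-> ->] /andP[_ ->]].
  by rewrite !andbT /=; apply/andP; split; apply: contraNneq Ncz => ->.
have ts : t \in u :: s by rewrite -ls mem_last.
have /NLP[y yL ty] := tNL.
have tC1 z : z \in C -> e t z -> z = y.
  by move=> zC tz; apply: (hole_one_neighbour hc (sC _ ts)) => //; apply: LC.
have c1p : c1 \in p by case: sp => ->; rewrite mem_rcons mem_head.
have c2q : c2 \in q by case: sq => ->; rewrite mem_rcons mem_head.
have c12 : c1 != c2 by case: (pq _ _ c1p c2q).
have c1C : c1 \in C by rewrite memC c1p !orbT.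
have c2C : c2 \in C by rewrite memC c2q !orbT.
have c1L : c1 \notin L.
  case: sp => _ _ _ _ dN; rewrite in_setU !in_set negb_or dN inE negb_or /=.
  apply/andP; split; first by apply: contraNneq aNp => <-.
  by apply/negP=> /q'q c1q; have [] := pq _ _ c1p c1q; rewrite eqxx.
have c2L : c2 \notin L.
  case: sq => _ _ _ _ dN; rewrite in_setU !in_set negb_or dN inE negb_or andbT.
  apply/andP; split; first by apply: contraNneq aNq => <-.
  by apply/negP=> /p'p c2p; have [] := pq _ _ c2p c2q; rewrite eqxx.
have c1tL : touches c1 L.
  case: sp => _ _ _ [_ lc1] _; exists (last a p'); last by rewrite e_sym.
  by rewrite in_setU in_set mem_last.
have c2tL : touches c2 L.
  case: sq => _ _ _ [_ lc2] _; exists (last a q'); last by rewrite e_sym.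
  by rewrite in_setU !in_set mem_last orbT.
have cNL : c \notin L.
  by apply/negP=> /LM; rewrite in_nonnbrs eqxx andbF.
have cc1 : e c c1 by case: sp.
have cc2 : e c c2 by case: sq.
have sN z : z \in u :: s -> [/\ z != c, z != c1, z != c2 & z \notin L].
  move=> /sC zC; split.
  - by apply: contraNneq zC => ->; rewrite memC eqxx orbT.
  - by apply: contraNneq zC => ->.
  - by apply: contraNneq zC => ->.
  - by apply: contra zC => /LC.
pose P z := e c1 z || e c2 z.
have cNu d : d \in C -> e c d -> ~~ e d u.
  move=> dC cd; apply/negP; rewrite e_sym => ud.
  by rewrite (uC1 d dC ud) e_irr in cd.
have PuN : ~~ P u by rewrite negb_or !cNu.
have PtN : ~~ P t.
  rewrite negb_or; apply/andP; split; rewrite e_sym; apply/negP => td.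
    by rewrite (tC1 _ c1C td) yL in c1L.
  by rewrite (tC1 _ c2C td) yL in c2L.
(* A vertex of the path that sees [c1] or [c2] is impossible: the first such vertex [z] precedes
   [t], and [no_first_attachment] applies with [d1] the one it sees. *)
have [has_P|NhasP] := boolP (has P s).
  exfalso; have [s1 [z [s2 [def_s Pz Ps1]]]] :
      exists s1 z s2, [/\ s = s1 ++ z :: s2, P z & ~~ has P s1].
    exists (take (find P s) s), (nth a s (find P s)), (drop (find P s).+1 s).
    split; last by rewrite has_take_leq ?ltnn // ltnW // -has_find.
      by rewrite -drop_nth -?has_find // cat_take_drop.
    exact: nth_find.
  have s20 : s2 <> [::].
    move=> s20; move: ls PtN; rewrite def_s s20 last_cat /= => <-.
    by rewrite Pz.
  have ls2 : last z s2 = t by rewrite -ls def_s last_cat.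
  have s1P x : x \in u :: s1 -> ~~ P x /\ ~ touches x L.
    move=> xs1; split.
      move: xs1; rewrite inE => /predU1P[-> //|xs1].
      by apply: contra Ps1 => Px; apply/hasP; exists x.
    move/NLP=> xNL; have : x \in t |: Q.
      by apply: sQ; rewrite def_s -cat_cons mem_cat xs1.
    rewrite in_setU1 => /predU1P[xt|/QP[_ _]]; last by rewrite xNL.
    move: uniq_s; rewrite def_s -cat_cons cat_uniq => /and3P[_ /hasPn/(_ x)].
    rewrite xs1 xt -ls2; case: (s2) s20 => // h s3 _.
    by rewrite last_cons inE mem_last orbT => /(_ isT).
  rewrite def_s in us uniq_s chs sN; rewrite -ls2 in ty.
  have tLs : touches (last z s2) L by exists y.
  case/orP: Pz => dz.
    apply: (@no_first_attachment L c c1 c2 u s1 z s2) => // x /s1P[].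
    by rewrite negb_or => /andP[].
  apply: (@no_first_attachment L c c2 c1 u s1 z s2); rewrite 1?eq_sym //.
    by move=> x /sN[].
  by move=> x /s1P[]; rewrite negb_or => /andP[].
have NP z : z \in s -> ~~ P z by move/hasPn: NhasP; apply.
have [h [s' def_s]] : exists h s', s = h :: s'.
  by case: (s) ls => [/= ut|h s' _]; [rewrite ut eqxx in tu|exists h, s'].
have uNs : u \notin s by case/andP: uniq_s.
have ts' : t \in s by move: ts; rewrite inE (negPf tu).
have uh : e u h by move: us; rewrite def_s /= => /andP[].
have cs : connected [set z in s].
  by rewrite def_s in us *; apply: connected_behead_path us.
have CL z : z \in C -> z != c -> [\/ z \in L, z = c1 | z = c2].
  rewrite memC => /or4P[/eqP->|/eqP->|zp|zq] zc; rewrite ?eqxx //.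
  - by apply: Or31.
  - by rewrite eqxx in zc.
  - move: zp; case: sp => -> _ _ _ _; rewrite mem_rcons inE => /predU1P[->|zp'].
      exact: Or32.
    by apply: Or31; rewrite !inE zp' orbT.
  - move: zq; case: sq => -> _ _ _ _; rewrite mem_rcons inE => /predU1P[->|zq'].
      exact: Or33.
    by apply: Or31; rewrite !inE zq' !orbT.
(* Here [r] is the arc with the attachment vertex [y]. The other arc [o] is kept, and [r] is
   replaced by the path [s] followed by [r']. *)
have outer r r' d o : side r r' d -> induced_link a c o -> a \notin r ->
    a \notin o -> c \notin o ->
    {in o & r, forall z t, z != t /\ ~~ e z t} -> {subset r <= S} ->
    {subset o <= S} -> {subset r <= C} -> {subset o <= C} ->
    {subset r' <= L} -> y \in a :: r' -> linked S a u.
  case=> def_r cd cr [ar' r'd] dN lo aNr aNo cNo or_ rS oS rC oC r'L yr'.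
  have r'r z : z \in r' -> z \in r.
    by rewrite def_r mem_rcons inE => ->; rewrite orbT.
  (* When [y] is [a] itself, [t] already sees [a]; adding [r'] would then disconnect the new side if
     [r'] is nonempty. *)
  pose E := if y \in r' then [set z in r'] else set0.
  have Er' z : z \in E -> z \in r' by rewrite /E; case: ifP; rewrite inE.
  apply: (@linked_detour S ([set z in s] :|: E) a c u o) => //.
  - apply/subsetP=> z; rewrite in_setU in_set => /orP[zs|/Er'/r'r/rS //].
    have [] := sM z; first by rewrite inE zs orbT.
    by rewrite in_setU1 => /predU1P[->//|]; rewrite in_nonnbrs => /and3P[].
  - rewrite /E; case: ifP => [yr''|_]; last by rewrite setU0.
    apply: (@connectedU _ _ t y) => //; rewrite ?inE //.
    by case: (r') ar' yr'' => // k r2 ar2 _; apply: connected_behead_path ar2.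
  - move=> x w; rewrite in_setU1 in_setU !in_set => xo.
    have xC : x \in C by case/predU1P: xo => [->|/oC //]; rewrite memC eqxx orbT.
    case/orP=> [ws|/Er' wr']; last first.
      case/predU1P: xo => [->|xo]; last by have [] := or_ x w xo (r'r _ wr').
      by have := LM _ (r'L _ wr'); rewrite in_nonnbrs => /and3P[].
    have wus : w \in u :: s by rewrite inE ws orbT.
    case/predU1P: xo => [->|xo].
      have [] := sM w wus; rewrite in_setU1 => /predU1P[wu|].
        by rewrite wu (negPf uNs) in ws.
      by rewrite in_nonnbrs => /and3P[].
    have xc : x != c by apply: contraNneq cNo => <-.
    (* The neighbour [x] of [w] is on [o]. If [w] is [t], then [x] is [y], which is not on [o];
       otherwise [w] sees neither [L] nor [c1] nor [c2]. *)
    apply/negP=> xw; have := sQ w wus; rewrite in_setU1 => /predU1P[wt|/QP[_ _]].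
      have xy : x = y by apply: tC1; rewrite // -wt e_sym.
      move: yr'; rewrite -xy inE => /predU1P[xa|/r'r xr].
        by rewrite -xa xo in aNo.
      by have [] := or_ _ _ xo xr; rewrite eqxx.
    case: (CL x xC xc) => [xL|xc1|xc2].
    - by case/NLP; exists x; rewrite // e_sym.
    - by have := NP w ws; rewrite /P -xc1 xw.
    - by have := NP w ws; rewrite /P -xc2 xw orbT.
  - rewrite disjoint_subset; apply/subsetP=> x; rewrite in_setU1 in_set => xo.
    have xC : x \in C by case/predU1P: xo => [->|/oC //]; rewrite memC eqxx orbT.
    rewrite inE /= in_setU in_set negb_or; apply/andP; split.
      by apply/negP=> xs; have := sC x; rewrite inE xs orbT xC => /(_ isT).
    apply/negP=> /Er' xr'; case/predU1P: xo => [xc|xo].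
      by have := r'L _ xr'; rewrite xc (negPf cNL).
    by have [] := or_ _ _ xo (r'r _ xr'); rewrite eqxx.
  - move: yr'; rewrite inE => /predU1P[ya|yr'].
      by exists t; [rewrite in_setU in_set ts'|rewrite e_sym -ya].
    have [k [r2 def_r']] : exists k r2, r' = k :: r2.
      by case: (r') yr' => // k r2 _; exists k, r2.
    exists k; first by rewrite /E yr' def_r' !inE eqxx orbT.
    by move: ar'; rewrite def_r' => /andP[].
  - by exists h; rewrite // in_setU in_set def_s mem_head.
  - rewrite inE (negPf u_c) /=; apply: contra uC; exact: oC.
  - rewrite in_setU in_set (negPf uNs) /=.
    by apply: contra uL => /Er' /r'L.
  - rewrite in_setU in_set negb_or; apply/andP; split.
      apply/negP=> as_; have := sC a; rewrite inE as_ orbT => /(_ isT).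
      by rewrite memC eqxx.
    by apply: contra aNr => /Er' /r'r.
have pC : {subset p <= C} by move=> z zp; rewrite memC zp !orbT.
have qC : {subset q <= C} by move=> z zq; rewrite memC zq !orbT.
have p'L : {subset p' <= L} by move=> z zp; rewrite !inE zp orbT.
have q'L : {subset q' <= L} by move=> z zq; rewrite !inE zq !orbT.
move: (yL); rewrite in_setU !in_set => /orP[yp|yq].
  exact: (outer p p' c1 q).
exact: (outer q q' c2 p).
Qed.

(** * Clique separators *)

(** The separating clique must avoid [a] and [u], and [Z] stands for the side of [a], a union of
    components. The empty clique is allowed. *)
Definition clique_inseparable (S : {set T}) (a u : T) : Prop :=
  forall K Z : {set T}, clique e K -> K \subset S -> a \notin K -> u \notin K ->
  Z \subset S :\: K -> a \in Z -> u \notin Z -> ~ anticomplete Z (S :\: K :\: Z).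

(** A separation of [K :|: X] by [K'] extends to [S]. If [K] meets [Z], then, [K] being a clique,
    the rest of [K] is in [Z] or [K'] and [Y] may join [Z]; otherwise [Z] lies in [X] and sees
    nothing of [Y]. *)
Lemma clique_inseparable_side (S K X Y : {set T}) a u :
  clique_inseparable S a u -> clique e K ->
  S = K :|: X :|: Y -> anticomplete X Y -> [disjoint Y & K :|: X] ->
  a \in K :|: X -> u \in K :|: X -> clique_inseparable (K :|: X) a u.
Proof.
move=> insep cK def_S XY dis aS uS K' Z cK' K'S aK' uK' ZS aZ uZ anti.
have NY y : y \in K :|: X -> y \notin Y by move=> yS; rewrite (disjointFl dis yS).
have ZP z : z \in Z -> (z \notin K') /\ (z \in K :|: X).
  by move/(subsetP ZS); rewrite in_setD => /andP[].
have subS : K :|: X \subset S by rewrite def_S subsetUl.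
have K'S' := subset_trans K'S subS.
have [/set0Pn[k /setIP[kK kZ]]|/negPn/eqP KZ] := boolP (K :&: Z != set0).
  apply: (insep K' (Z :|: Y)) => //.
  - apply/subsetP=> z /setUP[/ZP[zK' /(subsetP subS) zS]|zY].
      by rewrite in_setD zK'.
    rewrite in_setD def_S (in_setU z _ Y) zY orbT andbT.
    by apply: contraTN zY => /(subsetP K'S) /NY.
  - by rewrite in_setU aZ.
  - by rewrite in_setU negb_or uZ NY.
  - move=> z y zZY; rewrite in_setD in_setU negb_or => /andP[/andP[yZ yY]].
    rewrite in_setD def_S in_setU (negPf yY) orbF => /andP[yK' yS].
    have yout : y \in (K :|: X) :\: K' :\: Z by rewrite 2!in_setD yZ yK'.
    case/setUP: zZY => [zZ|zY]; first exact: anti.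
    case/setUP: yS => [yK|yX]; last by rewrite e_sym XY.
    have := anti k y kZ yout; rewrite (cK k y) //.
    by apply: contraNneq yZ => <-.
apply: (insep K' Z) => //.
  by apply/subsetP=> z /ZP[zK' /(subsetP subS) zS]; rewrite in_setD zK'.
move=> z y zZ; rewrite 2!in_setD => /and3P[yZ yK' yS].
have zX : z \in X.
  have [_ /setUP[zK|//]] := ZP z zZ.
  by have := in_set0 z; rewrite -KZ in_setI zK zZ.
move: yS; rewrite def_S in_setU => /orP[yS|yY]; last exact: XY.
by apply: anti; rewrite // 2!in_setD yZ yK'.
Qed.

(** If [a] and [u] are on a common side of a clique cutset, that side together with the clique is a
    smaller inseparable set. Otherwise the clique itself separates them. *)
Lemma minimal_no_clique_cutset (S : {set T}) a u :
  a \in S -> u \in S -> clique_inseparable S a u ->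
  (forall S' : {set T}, S' \proper S -> a \in S' -> u \in S' ->
     ~ clique_inseparable S' a u) ->
  no_clique_cutset S.
Proof.
move=> aS uS insep minS K X KS cK XS X0 Y0 XY.
set Y := S :\: K :\: X in Y0 XY.
have YX := anticompleteC XY.
have XP z : z \in X -> (z \notin K) /\ z \in S.
  by move/(subsetP XS); rewrite in_setD => /andP[].
have defS : S = K :|: X :|: Y.
  apply/setP=> z; rewrite /Y 2!in_setU 2!in_setD.
  have [/(subsetP KS)-> //|_] := boolP (z \in K).
  by have [/XP[_ ->]|] := boolP (z \in X).
have disY : [disjoint Y & K :|: X].
  rewrite disjoint_subset; apply/subsetP=> z; rewrite !inE negb_or.
  by case/and3P=> -> ->.
have defS' : S = K :|: Y :|: X by rewrite {1}defS setUAC.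
have disX : [disjoint X & K :|: Y].
  rewrite disjoint_subset; apply/subsetP=> z zX; have [zK _] := XP z zX.
  by rewrite inE /= in_setU in_setD zX orbF.
have side (A B : {set T}) : S = K :|: A :|: B -> anticomplete A B ->
    [disjoint B & K :|: A] -> B != set0 ->
    a \in K :|: A -> u \in K :|: A -> False.
  move=> dS AB dis /set0Pn[b bB] aA uA.
  apply: (minS (K :|: A)) => //; last first.
    exact: (clique_inseparable_side insep cK dS AB dis).
  apply/properP; split; first by rewrite dS subsetUl.
  by exists b; rewrite ?(disjointFr dis bB) // dS in_setU bB orbT.
have cut (A B : {set T}) z : S = K :|: A :|: B -> [disjoint B & K :|: A] ->
    z \in S -> z \notin K :|: A -> z \in B.
  by move=> dS _; rewrite {1}dS in_setU => /orP[->|].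
have [aX|aX] := boolP (a \in K :|: X); have [uX|uX] := boolP (u \in K :|: X).
- exact: side defS XY disY Y0 aX uX.
- have uY := cut _ _ _ defS disY uS uX.
  case/setUP: aX => [aK|aX].
    by apply: (side _ _ defS' YX disX X0); rewrite in_setU ?aK ?uY ?orbT.
  apply: (insep K X) => //.
  + by case: (XP a aX).
  + by apply: contra uX => uK; rewrite in_setU uK.
  + by apply: contra uX => uX; rewrite in_setU uX orbT.
- have aY := cut _ _ _ defS disY aS aX.
  case/setUP: uX => [uK|uX].
    by apply: (side _ _ defS' YX disX X0); rewrite in_setU ?uK ?aY ?orbT.
  apply: (insep K Y) => //.
  + by apply: contra aX => aK; rewrite in_setU aK.
  + by case: (XP u uX).
  + exact: subsetDl.
  + by rewrite in_setD uX.
  + move=> x z xY; rewrite 2!in_setD => /and3P[zY zK zS]; apply: YX => //.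
    by apply: contraNT zY => zX; rewrite 2!in_setD zX zK.
- have aY := cut _ _ _ defS disY aS aX; have uY := cut _ _ _ defS disY uS uX.
  by apply: (side _ _ defS' YX disX X0); rewrite in_setU ?aY ?uY orbT.
Qed.

Lemma clique_inseparable_hole (S : {set T}) a u :
  a \in S -> u \in S -> a != u -> ~~ e a u -> clique_inseparable S a u ->
  exists c, [/\ hole e c, a \in c, u \in c & {subset c <= S}].
Proof.
move=> aS uS au Nau insep.
pose P (S' : {set T}) :=
  [/\ S' \subset S, a \in S', u \in S' & clique_inseparable S' a u].
have [|S' [[S'S aS' uS' insep'] minS']] :=
  @exists_minimizer _ (fun A : {set T} => #|A|) P; first by exists S.
have ncS : no_clique_cutset S'.
  apply: (minimal_no_clique_cutset aS' uS') => // S2 S2S aS2 uS2 insep2.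
  have := proper_card S2S; rewrite ltnNge minS' //; split=> //.
  exact: subset_trans (proper_sub S2S) S'S.
have uM : u \in nonnbrs S' a by rewrite in_nonnbrs uS' eq_sym au.
have [d dM ld] := linked_start ncS aS' uM.
have [W1 [W2 [W1S W2S lk]]] : linked S' a u.
  (* Being linked to [a] spreads from [d] along edges to all nonneighbours of [a], in particular to
     [u]. *)
  apply: (@connected_ind (nonnbrs S' a) (linked S' a) d u) => //.
    exact: nonnbrs_connected.
  by move=> z t zM tM lz ezt; apply: (linked_step ncS aS' zM).
have [p [q [pW qW _ _ hc]]] := links_hole lk au Nau.
exists (a :: p ++ u :: rev q); split=> //.
- exact: mem_head.
- by rewrite !(inE, mem_cat) eqxx !orbT.
- move=> z; rewrite !(inE, mem_cat) mem_rev => /or4P[/eqP->|zp|/eqP->|zq] //.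
  + by apply/(subsetP S'S)/(subsetP W1S)/pW.
  + by apply/(subsetP S'S)/(subsetP W2S)/qW.
Qed.

Lemma seagull_clique_separator v a u : e v a -> e v u -> a != u ->
  exists K Z : {set T}, [/\ clique e K, v \notin K, a \notin K & u \notin K] /\
    [/\ Z \subset ~: (v |: K), a \in Z, u \notin Z &
        anticomplete Z (~: (v |: K) :\: Z)].
Proof.
move=> va vu au; have Nau : ~~ e a u by apply: no_triangle vu; rewrite e_sym.
have nv x : e v x -> x \in [set~ v].
  by move=> vx; rewrite !inE; apply: contraTneq vx => ->; rewrite e_irr.
apply: NNPP => nosep.
have [] : exists c, [/\ hole e c, a \in c, u \in c & {subset c <= [set~ v]}].
  apply: clique_inseparable_hole => //; try exact: nv.
  move=> K Z cK Kv aK uK ZS aZ uZ anti; apply: nosep; exists K, Z.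
  have vK : v \notin K by apply/negP=> /(subsetP Kv); rewrite !inE eqxx.
  have defS : ~: (v |: K) = [set~ v] :\: K by rewrite setCU setDE.
  by rewrite defS.
move=> c [hc ac uc cv]; case/eqP: au; apply: (hole_one_neighbour hc) va vu => //.
by apply/negP=> /cv; rewrite !inE eqxx.
Qed.

Lemma clique_card_le2 K : clique e K -> #|K| <= 2.
Proof.
move=> cK; rewrite leqNgt; apply/negP=> /card_gt2P[x [y [z [[xK yK zK] [xy yz zx]]]]].
have := no_triangle (cK _ _ xK yK xy) (cK _ _ yK zK yz).
by rewrite cK // eq_sym.
Qed.

(** * Weights and active separations *)

Lemma componentsP (S D : {set T}) :
  reflect (exists2 x, x \in S & D = component S x) (D \in components e S).
Proof. exact: imsetP. Qed.

Lemma component_eq S x y : y \in component S x -> component S y = component S x.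
Proof.
rewrite inE => /andP[yS xy]; apply/setP=> z; rewrite !inE; case: (z \in S) => //=.
by apply/idP/idP; apply: connect_trans; rewrite // induced_connect_sym.
Qed.

Lemma components_meet S D D' z : D \in components e S -> D' \in components e S ->
  z \in D -> z \in D' -> D = D'.
Proof.
by case/componentsP=> x _ -> /componentsP[x' _ ->] /component_eq<- /component_eq<-.
Qed.

Lemma components_disjoint S D D' : D \in components e S ->
  D' \in components e S -> D != D' -> [disjoint D & D'].
Proof.
move=> DS D'S; apply: contraNT => /pred0Pn[z /andP[zD zD']].
by rewrite (components_meet DS D'S zD zD').
Qed.

Section Weighted.

Variables (R : realFieldType) (w : T -> R).
Hypotheses (w_fun : weight_function w) (w_unb : unbalanced e w 4).

Import Order.TTheory GRing.Theory Num.Theory.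

Lemma weight_disjoint (D D' : {set T}) : [disjoint D & D'] ->
  (1 / 2 < weight w D)%R -> (weight w D' < 1 / 2)%R.
Proof.
move=> dis wD; case: w_fun => w01 sum1.
have : (weight w D + weight w D' <= 1)%R.
  have <- : weight w (D :|: D') = (weight w D + weight w D')%R.
    by rewrite /weight -bigU //; apply: eq_bigl => x; rewrite !inE.
  rewrite -sum1 (bigID (mem (D :|: D'))) /= -/(weight w (D :|: D')) lerDl.
  by apply: sumr_ge0 => x _; case/andP: (w01 x).
lra.
Qed.

(** Cliques have at most two vertices, so [K1 :|: K2] has at most four and leaves a component
    heavier than one half. It outweighs every other component, so [pick] succeeds. *)
Lemma BsetP (K1 K2 : {set T}) : clique e K1 -> clique e K2 ->
  Bset e w K1 K2 \in components e (~: (K1 :|: K2)) /\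
  (1 / 2 < weight w (Bset e w K1 K2))%R.
Proof.
move=> cK1 cK2.
have [D DS wD] : exists2 D, D \in components e (~: (K1 :|: K2)) &
    (1 / 2 < weight w D)%R.
  apply: NNPP => noD; apply: w_unb; exists (K1 :|: K2); split.
    apply: leq_trans (leq_card_setU _ _) _.
    by rewrite (leq_add (clique_card_le2 cK1) (clique_card_le2 cK2)).
  by move=> D DS; rewrite leNgt; apply/negP=> wD; apply: noD; exists D.
rewrite /Bset; case: pickP => [B /andP[BS /forall_inP maxB]|/(_ D)] /=.
  split=> //; have [-> //|DB] := eqVneq B D.
  apply: lt_trans wD _; apply: maxB; rewrite !inE DS andbT.
  by rewrite eq_sym.
rewrite DS /= => /negP[]; apply/forall_inP=> D'; rewrite !inE => /andP[D'D D'S].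
apply: (lt_trans _ wD); apply: weight_disjoint wD.
by apply: components_disjoint DS D'S _; rewrite eq_sym.
Qed.

Lemma Aset_Bset_anticomplete (K1 K2 : {set T}) : clique e K1 -> clique e K2 ->
  anticomplete (Aset e w K1 K2) (Bset e w K1 K2).
Proof.
move=> cK1 cK2 x y; rewrite inE -setUA in_setU negb_or => /andP[xB xK] yB.
have [/componentsP[z _ defB] _] := BsetP cK1 cK2.
apply: contra xB => xy; rewrite defB in yB *.
by apply: component_closed yB _ _; rewrite ?in_setC // e_sym.
Qed.

(** This is how heaviness enters: an inner vertex of degree at least three prevents the separation
    from failing properness by being a path. *)
Lemma induced_path_deg_le2 x p b : induced_path e (x :: p) ->
  b \in x :: p -> (forall y, e b y -> y \in x :: p) -> deg e b <= 2.
Proof.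
case=> _ up adj bp nb; set s := x :: p in up adj bp nb.
pose i := index b s.
(* At an end of the path the bounding set contains the default [x] or [b] itself, which is harmless
   for an upper bound. *)
have sub : nbh e b \subset [set nth x s i.+1; nth x s i.-1].
  apply/subsetP=> y; rewrite !inE => by_; have ys := nb y by_.
  move: by_; rewrite adj // => /orP[] /eqP E.
    by rewrite -/i in E; rewrite -E nth_index ?eqxx.
  by rewrite /i E nth_index ?eqxx ?orbT.
apply: leq_trans (subset_leq_card sub) _.
by rewrite cards2; case: (_ == _).
Qed.

(* Shrinking K1 and K2 to the neighbours of the component D of b keeps D a
   component; a vertex of degree at least 3 in D excludes the path. *)
Lemma proper_sep_of_vertex (K1 K2 : {set T}) b : clique e K1 -> clique e K2 ->
  b \notin Bset e w K1 K2 :|: K1 :|: K2 -> 2 < deg e b ->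
  exists K1' K2' : {set T},
    [/\ clique e K1', clique e K2', proper_sep e w K1' K2' &
        b \in Aset e w K1' K2'].
Proof.
move=> cK1 cK2; rewrite -setUA in_setU negb_or => /andP[bB bK] deg_b.
pose D := component (~: (K1 :|: K2)) b.
have bD : b \in D by apply: component_self; rewrite in_setC.
have DS : D \in components e (~: (K1 :|: K2)).
  by apply/componentsP; exists b; rewrite // in_setC.
have cliqueI K : clique e K -> clique e (K :&: nbhs e D).
  by move=> cK x y /setIP[xK _] /setIP[yK _]; apply: cK.
pose K1' := K1 :&: nbhs e D; pose K2' := K2 :&: nbhs e D.
have cK1' : clique e K1' by apply: cliqueI.
have cK2' : clique e K2' by apply: cliqueI.
have defK : K1' :|: K2' = (K1 :|: K2) :&: nbhs e D by rewrite setIUl.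
have DK x : x \in D -> x \notin K1 :|: K2.
  by move/(subsetP (component_sub _ _)); rewrite in_setC.
have D_closed x y : x \in D -> e x y -> y \notin K1' :|: K2' -> y \in D.
  move=> xD xy; rewrite defK in_setI negb_and => yK; apply: contraT => yD.
  have yN : y \in nbhs e D.
    by rewrite inE in_setC yD; apply/exists_inP; exists x; rewrite // e_sym.
  rewrite yN orbF in yK; case/negP: yD.
  by apply: component_closed xD _ xy; rewrite in_setC.
(* Stated for a general [S] because it is needed both for the complement of the new cliques and for
   their A-side. *)
have comp_D (S : {set T}) : D \subset S -> {in S, forall y, y \notin K1' :|: K2'} ->
    D \in components e S.
  move=> subD SK; apply/componentsP; exists b; first exact: subsetP bD.
  apply/eqP; rewrite eqEsubset; apply/andP; split; apply/subsetP=> x xD.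
    rewrite inE (subsetP subD) //; apply: (induced_connectS subD).
    exact: component_connected.
  apply: (@connected_ind (component S b) (fun z => z \in D) b x) => //.
  - exact: component_connected.
  - by apply: component_self; apply: (subsetP subD).
  - move=> z t _ /(subsetP (component_sub _ _)) tS zD zt.
    exact: D_closed zD zt (SK t tS).
(* [D] is disjoint from the old big component, so it weighs less than one half and cannot be the new
   big component. *)
have DB : [disjoint D & Bset e w K1' K2'].
  have [B'S wB'] := BsetP cK1' cK2'.
  have DS' : D \in components e (~: (K1' :|: K2')).
    apply: comp_D => [|y]; last by rewrite in_setC.
    apply/subsetP=> x /DK xK; rewrite in_setC defK in_setI.
    by rewrite (negPf xK).
  apply: (components_disjoint DS' B'S); apply: contraTneq wB' => <-.
  have [BS wB] := BsetP cK1 cK2; rewrite -leNgt ltW //.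
  apply: weight_disjoint wB; apply: components_disjoint BS DS _.
  by apply: contraNneq bB => ->.
have DA : D \subset Aset e w K1' K2'.
  apply/subsetP=> x xD; rewrite in_setC -setUA in_setU negb_or.
  by rewrite (disjointFr DB xD) defK in_setI (negPf (DK x xD)).
have AP x : x \in Aset e w K1' K2' -> x \notin K1' :|: K2'.
  by rewrite in_setC -setUA in_setU negb_or => /andP[].
exists K1', K2'; split=> //; last exact: (subsetP DA).
split.
  exists D; first exact: comp_D.
  by rewrite defK subsetIr.
move=> x y K1x K2y [p [ip lp setp]].
suff: deg e b <= 2 by rewrite leqNgt deg_b.
have bA := subsetP DA b bD.
have memp z : (z \in x :: p) = (z \in Aset e w K1' K2' :|: K1' :|: K2').
  by rewrite -setp in_set.
apply: (induced_path_deg_le2 ip).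
  by rewrite memp -setUA in_setU bA.
move=> z bz; rewrite memp; apply: contraT.
rewrite -setUA in_setU negb_or => /andP[zA zK].
have zB : z \in Bset e w K1' K2'.
  by move: zA; rewrite in_setC negbK -setUA in_setU (negPf zK) orbF.
by have := Aset_Bset_anticomplete cK1' cK2' bA zB; rewrite bz.
Qed.

(* A proper separation is determined by its A-side, since its middle part is
   the neighbourhood of A; hence minimality of the complement of A suffices. *)
Lemma active_sep_above (K1 K2 X : {set T}) : clique e K1 -> clique e K2 ->
  proper_sep e w K1 K2 -> Aset e w K1 K2 :&: X <> set0 ->
  exists K1' K2' : {set T},
    [/\ clique e K1', clique e K2', active_sep e w K1' K2' &
        Aset e w K1' K2' :&: X <> set0].
Proof.
move=> cK1 cK2 pK AX.
pose Y (K : {set T} * {set T}) := Bset e w K.1 K.2 :|: K.1 :|: K.2.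
have AY K : Aset e w K.1 K.2 = ~: Y K by [].
pose P (K : {set T} * {set T}) := [/\ clique e K.1, clique e K.2,
  proper_sep e w K.1 K.2 & Aset e w K.1 K.2 :&: X <> set0].
have [|[L1 L2] [[/= cL1 cL2 pL AL] minL]] :=
  @exists_minimizer _ (fun K => #|Y K|) P; first by exists (K1, K2).
exists L1, L2; split=> //; split=> // M1 M2 cM1 cM2 pM _; split.
  apply/negP=> ltY; have := proper_card ltY.
  rewrite ltnNge (minL (M1, M2)) //; split=> //= AM; apply: AL; apply/eqP.
  rewrite -subset0 -AM; apply: setSI.
  by rewrite (AY (L1, L2)) (AY (M1, M2)) setCS proper_sub.
(* Equal complements give equal A-sides. A vertex of [M]'s big component in [L1 :|: L2] would have a
   neighbour in this A-side, by properness of the pair [L1], [L2]. *)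
move=> eqY; apply/subsetP=> x xB.
have eqA : Aset e w M1 M2 = Aset e w L1 L2 by rewrite /Aset eqY.
have [BM _] := BsetP cM1 cM2.
have inM z : z \in Bset e w M1 M2 -> z \notin M1 :|: M2.
  have /componentsP[z0 _ ->] := BM.
  by move/(subsetP (component_sub _ _)); rewrite in_setC.
have : x \in Y (L1, L2) by rewrite -[Y _]eqY -setUA in_setU xB.
rewrite /Y /= -setUA in_setU => /orP[//|xL]; case: pL => [[D DA subL] _].
have := subsetP subL x xL; rewrite inE => /andP[_ /exists_inP[y yD xy]].
have yA : y \in Aset e w M1 M2.
  rewrite eqA; have /componentsP[y0 _ defD] := DA.
  by rewrite defD in yD; apply: subsetP yD; apply: component_sub.
by have := Aset_Bset_anticomplete cM1 cM2 yA xB; rewrite e_sym xy.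
Qed.

End Weighted.

End Graph.

(** * Heavy seagulls and active separations *)

Theorem theorem6p3 (R : realFieldType) (T : finType) (e : rel T) (w : T -> R)
    (a v1 u1 : T) :
  simple_graph e -> class_F2 e ->
  weight_function w -> unbalanced e w 4 ->
  ~ admits_star_cutset e ->
  heavy_seagull e a v1 u1 ->
  exists K1 K2 : {set T},
    [/\ clique e K1, clique e K2, active_sep e w K1 K2 &
        Aset e w K1 K2 :&: [set a; u1] <> set0].
Proof.
move=> [e_sym e_irr] [e_tf e_sparse _ _] w_fun w_unb _.
case=> [[_ uniq_s adj] deg_a deg_u].
move: (uniq_s); rewrite /= !inE negb_or andbT => /andP[/andP[av au] vu].
have va : e v1 a.
  by rewrite adj ?inE ?eqxx ?orbT //= !eqxx (negPf av).
have vu1 : e v1 u1.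
  by rewrite adj ?inE ?eqxx ?orbT //= !eqxx (negPf av) (negPf au) (negPf vu).
have [K [Z [[cK vK aK uK] [ZS aZ uZ anti]]]] :=
  seagull_clique_separator e_sym e_irr e_tf e_sparse va vu1 au.
have cv : clique e [set v1] by move=> ? ? /set1P-> /set1P->; rewrite eqxx.
have [/componentsP[z zS defB] _] := BsetP e_sym e_tf w_fun w_unb cv cK.
have [b [bX bB deg_b]] : exists b,
    [/\ b \in [set a; u1], b \notin Bset e w [set v1] K & 2 < deg e b].
  (* If the big component contains [a], it stays inside [Z], because no edge leaves [Z] outside
     [v1 |: K]; hence it misses [u1]. *)
  have [aB|aB] := boolP (a \in Bset e w [set v1] K); last first.
    by exists a; rewrite !inE eqxx.
  exists u1; rewrite !inE eqxx orbT; split=> //; apply: contra uZ => uB.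
  rewrite defB in aB uB.
  apply: (@connected_ind _ e (component e (~: (v1 |: K)) z)
            (fun y => y \in Z) a u1) => //.
    exact: component_connected.
  move=> x y _ /(subsetP (component_sub _ _ _)) yS xZ xy; apply: contraT => yZ.
  by have := anti x y xZ; rewrite in_setD yZ yS xy => /(_ isT).
have bK : b \notin Bset e w [set v1] K :|: [set v1] :|: K.
  rewrite -setUA in_setU (negPf bB) in_setU1 /= negb_or.
  have uv : u1 != v1 by rewrite eq_sym.
  by case/set2P: bX => ->; rewrite ?aK ?uK ?av ?uv.
have [K1 [K2 [cK1 cK2 pK bA]]] :=
  proper_sep_of_vertex e_sym e_tf w_fun w_unb cv cK bK deg_b.
apply: (active_sep_above e_sym e_tf w_fun w_unb cK1 cK2 pK) => A0.
by have := in_set0 b; rewrite -A0 in_setI bA bX.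
Qed.
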